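(* Let $A$ be a Cayley-Dickson imaginaroid for which the multiplication on the suspension $SA$ is associative, i.e. $(xy)z = x(yz)$ for all $x,y,z : SA$. Then the join $SA * SA$ can be given the structure of an H-space.
   Context: The setting is homotopy type theory: Martin-Löf dependent type theory with univalent universes and higher inductive types; equalities are (proof-relevant) identifications, so laws are given as structure. The suspension $SA$ of a type $A$ is the higher inductive type with point constructors $\mathsf{N},\mathsf{S} : SA$ and path constructor $\mathsf{merid} : A \to (\mathsf{N} = \mathsf{S})$. The join $A * B$ of types $A$ and $B$ is the pushout of the projections $A \leftarrow A \times B \to B$, i.e. the higher inductive type with point constructors $\mathsf{inl} : A \to A*B$, $\mathsf{inr} : B \to A*B$ and path constructor $\mathsf{glue} : \Pi_{(a:A)}\Pi_{(b:B)}\,\mathsf{inl}(a) = \mathsf{inr}(b)$. An H-space is a pointed type $(X,e)$ with a multiplication $\mu : X \times X \to X$ and homotopies $\mu(e,-) \sim \mathsf{id}_X$ and $\mu(-,e) \sim \mathsf{id}_X$, such that for each $x : X$ the maps $\mu(x,-)$ and $\mu(-,x)$ are equivalences. If $A$ is a type with a negation operation $a \mapsto -a$, then the suspension $SA$ gets a conjugation $x \mapsto x^*$ and a negation $x \mapsto -x$, defined by suspension recursion: $\mathsf{N}^* := \mathsf{N}$, $\mathsf{S}^* := \mathsf{S}$, and conjugation sends the path $\mathsf{merid}\,a$ to $\mathsf{merid}(-a)$; $-\mathsf{N} := \mathsf{S}$, $-\mathsf{S} := \mathsf{N}$, and negation sends the path $\mathsf{merid}\,a$ to $(\mathsf{merid}(-a))^{-1}$.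 The base point of $SA$ is $\mathsf{N}$, also written $1$. A Cayley-Dickson imaginaroid consists of a type $A$ with an involutive negation ($-(-a) = a$ for all $a : A$), together with a binary multiplication operation $(x,y) \mapsto xy$ on $SA$ making $SA$ (with base point $1 = \mathsf{N}$) an H-space, and satisfying, for all $x,y : SA$, the laws $x(-y) = -(xy)$, $xx^* = 1$ and $(xy)^* = y^*x^*$. *)

(* Defs.v *)
(* Book-style homotopy type theory, with Rocq's types as the types.  The
   identity type [paths] is a proof-relevant inductive family in [Type]; all
   laws below are data valued in it, never in the [Prop]-valued [eq].  The two
   higher inductive types are given by their constructors, their dependent
   induction principle and its computation rules, all of the latter stated as
   identifications. *)

Set Implicit Arguments.
Unset Strict Implicit.
Unset Printing Implicit Defensive.

Declare Scope path_scope.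
Delimit Scope path_scope with path.

(* Template polymorphism is switched off so that [paths] never lands in
   [Prop]. *)
#[universes(template = no)]
Inductive paths (A : Type) (x : A) : A -> Type :=
  idpath : paths x x.

Arguments idpath {A x}, [A] x.

Notation "x == y" := (paths x y) (at level 70, no associativity) : path_scope.
Local Open Scope path_scope.

Definition inverse (A : Type) (x y : A) (p : x == y) : y == x :=
  match p in _ == z return z == x with idpath => idpath end.

Definition concat (A : Type) (x y z : A) (p : x == y) (q : y == z) : x == z :=
  match q in _ == w return x == w with idpath => p end.

Definition transport (A : Type) (P : A -> Type) (x y : A) (p : x == y)
    (u : P x) : P y :=
  match p in _ == z return P z with idpath => u end.

Definition ap (A B : Type) (f : A -> B) (x y : A) (p : x == y) : f x == f y :=
  match p in _ == z return f x == f z with idpath => idpath end.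

Definition apd (A : Type) (P : A -> Type) (f : forall x, P x) (x y : A)
    (p : x == y) : transport (P := P) p (f x) == f y :=
  match p in _ == z return transport (P := P) p (f x) == f z with
  | idpath => idpath
  end.

Definition transport_const (A B : Type) (x y : A) (p : x == y) (b : B) :
    transport (P := fun _ => B) p b == b :=
  match p in _ == z return transport (P := fun _ => B) p b == b with
  | idpath => idpath
  end.

(* Bi-invertibility: a right homotopy inverse and a left one. *)
Definition IsEquiv (A B : Type) (f : A -> B) : Type :=
  { g : B -> A & forall b, f (g b) == b } *
  { h : B -> A & forall a, h (f a) == a }.

Definition happly (A : Type) (P : A -> Type) (f g : forall x, P x)
    (p : f == g) : forall x, f x == g x :=
  fun x => ap (fun k : forall x, P x => k x) p.

(* The one consequence of univalence that is assumed; univalence itself is not. *)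
Definition Funext : Type :=
  forall (A : Type) (P : A -> Type) (f g : forall x, P x),
    IsEquiv (@happly A P f g).

Record Suspension (A : Type) := {
  susp_type :> Type;
  north : susp_type;
  south : susp_type;
  merid : A -> north == south;
  susp_ind : forall (P : susp_type -> Type) (n : P north) (s : P south)
    (m : forall a, transport (P := P) (merid a) n == s) (x : susp_type), P x;
  susp_ind_north : forall (P : susp_type -> Type) (n : P north) (s : P south)
    (m : forall a, transport (P := P) (merid a) n == s),
    susp_ind m north == n;
  susp_ind_south : forall (P : susp_type -> Type) (n : P north) (s : P south)
    (m : forall a, transport (P := P) (merid a) n == s),
    susp_ind m south == s;
  (* "apd of the eliminator on merid a is m a", along the two rules above *)
  susp_ind_merid : forall (P : susp_type -> Type) (n : P north) (s : P south)
    (m : forall a, transport (P := P) (merid a) n == s) (a : A),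
    apd (susp_ind m) (merid a) ==
    concat (ap (transport (P := P) (merid a)) (susp_ind_north m))
      (concat (m a) (inverse (susp_ind_south m)))
}.

Arguments north {A} SA : rename.
Arguments south {A} SA : rename.
Arguments merid {A} SA a : rename.
Arguments susp_ind {A} SA P n s m x : rename.
Arguments susp_ind_north {A} SA P n s m : rename.
Arguments susp_ind_south {A} SA P n s m : rename.
Arguments susp_ind_merid {A} SA P n s m a : rename.

Definition susp_rec (A : Type) (SA : Suspension A) (B : Type) (n s : B)
    (m : A -> n == s) : SA -> B :=
  susp_ind SA (fun _ => B) n s
    (fun a => concat (transport_const (merid SA a) n) (m a)).

Record Join (A B : Type) := {
  join_type :> Type;
  join_inl : A -> join_type;
  join_inr : B -> join_type;
  join_glue : forall a b, join_inl a == join_inr b;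
  join_ind : forall (P : join_type -> Type)
    (f : forall a, P (join_inl a)) (g : forall b, P (join_inr b))
    (h : forall a b, transport (P := P) (join_glue a b) (f a) == g b)
    (x : join_type), P x;
  join_ind_inl : forall (P : join_type -> Type)
    (f : forall a, P (join_inl a)) (g : forall b, P (join_inr b))
    (h : forall a b, transport (P := P) (join_glue a b) (f a) == g b) (a : A),
    join_ind h (join_inl a) == f a;
  join_ind_inr : forall (P : join_type -> Type)
    (f : forall a, P (join_inl a)) (g : forall b, P (join_inr b))
    (h : forall a b, transport (P := P) (join_glue a b) (f a) == g b) (b : B),
    join_ind h (join_inr b) == g b;
  join_ind_glue : forall (P : join_type -> Type)
    (f : forall a, P (join_inl a)) (g : forall b, P (join_inr b))
    (h : forall a b, transport (P := P) (join_glue a b) (f a) == g b)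
    (a : A) (b : B),
    apd (join_ind h) (join_glue a b) ==
    concat (ap (transport (P := P) (join_glue a b)) (join_ind_inl h a))
      (concat (h a b) (inverse (join_ind_inr h b)))
}.

Arguments join_inl {A B} J a : rename.
Arguments join_inr {A B} J b : rename.
Arguments join_glue {A B} J a b : rename.
Arguments join_ind {A B} J P f g h x : rename.
Arguments join_ind_inl {A B} J P f g h a : rename.
Arguments join_ind_inr {A B} J P f g h b : rename.
Arguments join_ind_glue {A B} J P f g h a b : rename.

Record HSpace (X : Type) (e : X) := {
  hmul :> X -> X -> X;
  hmul_1l : forall x, hmul e x == x;
  hmul_1r : forall x, hmul x e == x;
  hmul_equiv_l : forall x, IsEquiv (fun y => hmul x y);
  hmul_equiv_r : forall x, IsEquiv (fun y => hmul y x)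
}.

Definition susp_conj (A : Type) (neg : A -> A) (SA : Suspension A) : SA -> SA :=
  susp_rec (fun a => merid SA (neg a)).

Definition susp_neg (A : Type) (neg : A -> A) (SA : Suspension A) : SA -> SA :=
  susp_rec (fun a => inverse (merid SA (neg a))).

(* The suspension of [A] is a parameter, since [Suspension A] is the type of
   all its presentations. *)
Record CayleyDicksonImaginaroid (A : Type) (SA : Suspension A) := {
  cd_neg : A -> A;
  cd_negK : forall a, cd_neg (cd_neg a) == a;
  cd_mul : HSpace (north SA);
  cd_mulN : forall x y : SA,
    cd_mul x (susp_neg cd_neg y) == susp_neg cd_neg (cd_mul x y);
  cd_mul_conj : forall x : SA, cd_mul x (susp_conj cd_neg x) == north SA;
  cd_conj_mul : forall x y : SA,
    susp_conj cd_neg (cd_mul x y) ==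
    cd_mul (susp_conj cd_neg y) (susp_conj cd_neg x)
}.

(* Main.v *)
(* On the join, the Cayley-Dickson product is [inl a * inl c = inl (a c)],
   [inl a * inr d = inr (a^* d)], [inr b * inl c = inr (c b)] and
   [inr b * inr d = inl ((- d) b^* )].  It extends over the glue paths as soon
   as every diamond of four glue paths on the corners [a c], [(- d) b^*] (in
   [inl]) and [c b], [a^* d] (in [inr]) commutes.  By associativity these
   corners are [f w], [f S], [g w], [g N] for the translates [f u = (d u) b^*]
   and [g u = (a^* d) u] and a suitable [w]; and such a diamond is filled by
   suspension induction on [w], because it degenerates at [w = N] and at
   [w = S], and the two degenerate fillers agree.  Translations in the join
   are equivalences because the join is connected and being an equivalence is
   a proposition, so that only the translations by the unit matter. *)

Require Import Defs.

Set Implicit Arguments.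
Unset Strict Implicit.
Unset Printing Implicit Defensive.

Local Open Scope path_scope.

(** * Path algebra and homotopies over a path *)

Definition concat_1p (A : Type) (x y : A) (p : x == y) :
    concat idpath p == p :=
  match p with idpath => idpath end.

Lemma concat_pV (A : Type) (x y : A) (p : x == y) :
  concat p (inverse p) == idpath.
Proof. destruct p; exact idpath. Defined.

Lemma concat_pp_p (A : Type) (x y z w : A) (p : x == y) (q : y == z)
    (r : z == w) :
  concat (concat p q) r == concat p (concat q r).
Proof. destruct r; exact idpath. Defined.

Lemma concat_pp_V_p (A : Type) (x y z w v : A) (p : x == y) (q : y == z)
    (r : w == z) (s : z == v) :
  concat (concat p (concat q (inverse r))) (concat r s) ==
  concat p (concat q s).
Proof. destruct s, r, q; exact idpath. Defined.

Lemma happly_concat (A B : Type) (f g h : A -> B) (p : f == g) (q : g == h)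
    (x : A) :
  happly (concat p q) x == concat (happly p x) (happly q x).
Proof. destruct q; exact idpath. Defined.

Lemma happly_inverse (A B : Type) (f g : A -> B) (p : f == g) (x : A) :
  happly (inverse p) x == inverse (happly p x).
Proof. destruct p; exact idpath. Defined.

Lemma ap_apply_r (X A B : Type) (F : X -> A -> B) (x y : X) (p : x == y)
    (a : A) :
  ap (fun x => F x a) p == happly (ap F p) a.
Proof. destruct p; exact idpath. Defined.

(** Turns the computation rule of an eliminator at a constant family into the rule for [ap]; [u] and
    [v] are meant to be its point rules. *)
Lemma ap_of_apd_const (X B : Type) (F : X -> B) (x y : X) (p : x == y)
    (n s : B) (u : F x == n) (v : F y == s) (m : n == s) :
  apd F p == concat (ap (transport (P := fun _ => B) p) u)
               (concat (concat (transport_const p n) m) (inverse v)) ->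
  ap F p == concat u (concat m (inverse v)).
Proof.
destruct p, u, m; intros H.
exact H.
Defined.

(* The identifications [u0], [v0], [u1], [v1] are meant to be the point
   computation rules of two eliminators [F] and [G]. *)
Lemma transport_homotopy (X B : Type) (F G : X -> B) (x y : X) (p : x == y)
    (f0 f1 g0 g1 : B) (u0 : F x == f0) (u1 : F y == f1) (v0 : G x == g0)
    (v1 : G y == g1) (phi : f0 == f1) (gam : g0 == g1)
    (hF : ap F p == concat u0 (concat phi (inverse u1)))
    (hG : ap G p == concat v0 (concat gam (inverse v1)))
    (q0 : f0 == g0) (q1 : f1 == g1) (sq : concat q0 gam == concat phi q1) :
  transport (P := fun z => F z == G z) p
    (concat u0 (concat q0 (inverse v0))) ==
  concat u1 (concat q1 (inverse v1)).
Proof.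
destruct p, u0, u1, v0, v1; simpl in *.
assert (hphi : phi == idpath) by
  exact (inverse (concat hF (concat_1p phi))).
assert (hgam : gam == idpath) by
  exact (inverse (concat hG (concat_1p gam))).
apply (ap (fun q => concat idpath q)).
refine (concat _ (concat_1p q1)).
refine (concat _ (ap (fun r => concat r q1) hphi)).
exact (concat (ap (concat q0) (inverse hgam)) sq).
Defined.

(** * Contractibility and function extensionality *)

Definition Contr (A : Type) : Type := { c : A & forall x, c == x }.

Lemma contr_path (A : Type) (C : Contr A) (x y : A) : x == y.
Proof.
destruct C as [c h]; exact (concat (inverse (h x)) (h y)).
Defined.

Lemma contr_prod (A B : Type) : Contr A -> Contr B -> Contr (A * B).
Proof.
intros [a ha] [b hb]; exists (a, b); intros [x y].
destruct (ha x), (hb y); exact idpath.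
Defined.

Definition funext_path (funext : Funext) (A : Type) (P : A -> Type)
    (f g : forall x, P x) : (forall x, f x == g x) -> f == g :=
  projT1 (fst (funext A P f g)).

Definition happly_funext_path (funext : Funext) (A : Type) (P : A -> Type)
    (f g : forall x, P x) (h : forall x, f x == g x) :
    happly (funext_path funext h) == h :=
  projT2 (fst (funext A P f g)) h.

(** By function extensionality every homotopy comes from a path, and paths with one free endpoint
    contract. *)
Lemma contr_homotopy_to (funext : Funext) (A B : Type) (f : A -> B) :
  Contr { g : A -> B & forall x, g x == f x }.
Proof.
exists (existT _ f (fun x => idpath)); intros [g h].
destruct (happly_funext_path funext h).
generalize (funext_path funext h) as p; intros p.
destruct p; exact idpath.
Defined.

(** At the identity, both factors of [IsEquiv] are types of maps homotopic to the identity. *)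
Lemma contr_isequiv_idmap (funext : Funext) (A : Type) (f : A -> A) :
  (forall x, f x == x) -> Contr (IsEquiv f).
Proof.
intros h.
apply (transport (P := fun k => Contr (IsEquiv k))
  (inverse (funext_path funext (P := fun _ => A) h))).
exact (contr_prod (contr_homotopy_to funext (fun x : A => x))
  (contr_homotopy_to funext (fun x : A => x))).
Defined.

(** * Joins: recursion, connectedness and diamonds of glue paths *)

Section Join.

Variables (X Y : Type) (J : Join X Y).

Definition join_rec (B : Type) (f : X -> B) (g : Y -> B)
    (h : forall x y, f x == g y) : J -> B :=
  join_ind J (fun _ => B) f g
    (fun x y => concat (transport_const (join_glue J x y) (f x)) (h x y)).

Section JoinRec.

Variables (B : Type) (f : X -> B) (g : Y -> B) (h : forall x y, f x == g y).

Definition join_rec_inl (x : X) : join_rec h (join_inl J x) == f x :=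
  join_ind_inl J (fun _ => B) f g _ x.

Definition join_rec_inr (y : Y) : join_rec h (join_inr J y) == g y :=
  join_ind_inr J (fun _ => B) f g _ y.

Lemma join_rec_glue (x : X) (y : Y) :
  ap (join_rec h) (join_glue J x y) ==
  concat (join_rec_inl x) (concat (h x y) (inverse (join_rec_inr y))).
Proof. exact (ap_of_apd_const (join_ind_glue J (fun _ => B) f g _ x y)). Defined.

End JoinRec.

Lemma join_glue_natural (x x' : X) (y y' : Y) (p : x == x') (q : y == y') :
  concat (ap (join_inl J) p) (join_glue J x' y') ==
  concat (join_glue J x y) (ap (join_inr J) q).
Proof. destruct p, q; exact (concat_1p _). Defined.

(** Contractibility travels along glue from [inl x0] to every [inr y], and from [inr y0] back to
    every [inl x]; this also settles the glue case. *)
Lemma join_connected (x0 : X) (y0 : Y) (P : J -> Type) :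
  Contr (P (join_inl J x0)) -> forall z, P z.
Proof.
intros C.
assert (Cr : forall y, Contr (P (join_inr J y))) by
  exact (fun y => transport (P := fun z => Contr (P z)) (join_glue J x0 y) C).
assert (Cl : forall x, Contr (P (join_inl J x))) by
  exact (fun x => transport (P := fun z => Contr (P z))
                    (inverse (join_glue J x y0)) (Cr y0)).
exact (join_ind J P (fun x => projT1 (Cl x)) (fun y => projT1 (Cr y))
  (fun x y => contr_path (Cr y) _ _)).
Defined.

Definition diamond (x x' : X) (y y' : Y) : Type :=
  concat (join_glue J x y) (inverse (join_glue J x' y)) ==
  concat (join_glue J x y') (inverse (join_glue J x' y')).

Lemma diamond_susp (A : Type) (SA : Suspension A) (f : SA -> X) (g : SA -> Y)
    (w : SA) :
  diamond (f w) (f (south SA)) (g w) (g (north SA)).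
Proof.
revert w; apply (susp_ind SA
  (fun w => diamond (f w) (f (south SA)) (g w) (g (north SA)))
  idpath (concat (concat_pV _) (inverse (concat_pV _)))).
(* Path induction turns [south SA] into [north SA] in the fixed corner too, so both fillers now fill
   the same diamond. *)
intros a; destruct (merid SA a); simpl.
destruct (concat_pV _); exact idpath.
Defined.

End Join.

Arguments join_rec {X Y} J {B f g} h x.
Arguments join_rec_inl {X Y J B f g} h x.
Arguments join_rec_inr {X Y J B f g} h y.
Arguments join_rec_glue {X Y J B f g} h x y.

(** * The multiplication on the join of a suspension with itself *)

Section GroupLikeSuspension.

Variables (funext : Funext) (A : Type) (SA : Suspension A).
Variables (mul : HSpace (north SA)) (inv : SA -> SA).
Hypothesis mulA : forall x y z : SA, mul (mul x y) z == mul x (mul y z).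
Hypothesis mulV : forall x : SA, mul x (inv x) == north SA.
Variable J : Join SA SA.

Lemma mul_mulV (x y : SA) : mul x (mul (inv x) y) == y.
Proof.
refine (concat (inverse (mulA x (inv x) y)) _).
exact (concat (ap (fun t => mul t y) (mulV x)) (hmul_1l mul y)).
Defined.

Lemma inv_north : inv (north SA) == north SA.
Proof. exact (concat (inverse (hmul_1l mul _)) (mulV _)). Defined.

(* [mul d (south SA)] plays the role of [- d]. *)
Definition corner (b d : SA) : SA := mul (mul d (south SA)) (inv b).

Lemma mul_diamond (a b c d : SA) :
  diamond J (mul a c) (corner b d) (mul c b) (mul (inv a) d).
Proof.
(* [w] is chosen to solve [e w = c b]. As [a e = d], this gives [d w = a (c b)], and multiplying by
   [inv b] on the right leaves [a c]. *)
set (e := mul (inv a) d); set (w := mul (inv e) (mul c b)).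
set (f := fun u => mul (mul d u) (inv b)); set (g := fun u => mul e u).
assert (gw : g w == mul c b) by exact (mul_mulV e _).
assert (g1 : g (north SA) == e) by exact (hmul_1r mul e).
assert (fw : f w == mul a c).
{ unfold f.
  refine (concat (ap (fun t => mul (mul t w) (inv b))
                    (inverse (mul_mulV a d))) _); fold e.
  refine (concat (ap (fun t => mul t (inv b)) (mulA a e w)) _).
  refine (concat (ap (fun t => mul (mul a t) (inv b)) gw) _).
  refine (concat (mulA _ _ _) (ap (fun t => mul a t) _)).
  refine (concat (mulA _ _ _) _).
  exact (concat (ap (fun t => mul c t) (mulV b)) (hmul_1r mul c)). }
change (diamond J (mul a c) (f (south SA)) (mul c b) e).
apply (transport (P := fun t => diamond J t _ _ _) fw).
apply (transport (P := fun t => diamond J _ _ t _) gw).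
apply (transport (P := fun t => diamond J _ _ _ t) g1).
exact (diamond_susp J f g w).
Defined.

Definition join_mul_inl (a : SA) : J -> J :=
  join_rec J (fun c d => join_glue J (mul a c) (mul (inv a) d)).

Definition join_mul_inr (b : SA) : J -> J :=
  join_rec J
    (fun c d => inverse (join_glue J (corner b d) (mul c b))).

(** The glue path is wrapped in point rules as [transport_homotopy] expects; the square left to fill
    is then a diamond. *)
Definition join_mul_glue_inl (a b c : SA) :
    join_mul_inl a (join_inl J c) == join_mul_inr b (join_inl J c) :=
  concat (join_rec_inl _ c) (concat (join_glue J (mul a c) (mul c b))
    (inverse (join_rec_inl _ c))).

Definition join_mul_glue_inr (a b d : SA) :
    join_mul_inl a (join_inr J d) == join_mul_inr b (join_inr J d) :=
  concat (join_rec_inr _ d)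
    (concat (inverse (join_glue J (corner b d) (mul (inv a) d)))
      (inverse (join_rec_inr _ d))).

Definition join_mul_glue (a b : SA) :
    forall y, join_mul_inl a y == join_mul_inr b y :=
  join_ind J (fun y => join_mul_inl a y == join_mul_inr b y)
    (join_mul_glue_inl a b) (join_mul_glue_inr a b)
    (fun c d => transport_homotopy (join_rec_glue _ c d) (join_rec_glue _ c d)
      (mul_diamond a b c d)).

Definition join_mul : J -> J -> J :=
  join_rec J (fun a b => funext_path funext (join_mul_glue a b)).

Lemma join_mul_1l (y : J) : join_mul (join_inl J (north SA)) y == y.
Proof.
refine (concat (happly (join_rec_inl _ (north SA)) y) _).
revert y; refine (join_ind J
  (fun y => join_mul_inl (north SA) y == y)
  (fun c => concat (join_rec_inl _ c)
     (* [idpath] stands for the point rule of the identity map. *)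
     (concat (ap (join_inl J) (hmul_1l mul c)) (inverse idpath)))
  (fun d => concat (join_rec_inr _ d)
     (concat (ap (join_inr J) (concat (ap (fun t => mul t d) inv_north)
        (hmul_1l mul d))) (inverse idpath)))
  (fun c d => transport_homotopy (G := fun y => y)
     (gam := join_glue J c d) (join_rec_glue _ c d) _ _)).
- destruct (join_glue J c d); exact idpath.
- apply join_glue_natural.
Defined.

(** [happly] undoes [funext_path], so right translation by [y] acts on glue through
    [join_mul_glue]. *)
Lemma ap_join_mul_glue (a b : SA) (y : J) :
  ap (fun x => join_mul x y) (join_glue J a b) ==
  concat (happly (join_rec_inl _ a) y)
    (concat (join_mul_glue a b y) (inverse (happly (join_rec_inr _ b) y))).
Proof.
refine (concat (ap_apply_r join_mul _ y) _).
refine (concat (ap (fun q => happly q y) (join_rec_glue _ a b)) _).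
refine (concat (happly_concat _ _ y) (ap (concat _) _)).
refine (concat (happly_concat _ _ y) _).
refine (concat (ap (concat _) (happly_inverse _ y)) _).
exact (ap (fun k => concat (k y) _) (happly_funext_path funext _)).
Defined.

Lemma join_mul_1r (x : J) : join_mul x (join_inl J (north SA)) == x.
Proof.
set (e := join_inl J (north SA)).
revert x; refine (join_ind J (fun x => join_mul x e == x)
  (fun a => concat (happly (join_rec_inl _ a) e)
     (concat (concat (join_rec_inl _ (north SA))
        (ap (join_inl J) (hmul_1r mul a))) (inverse idpath)))
  (fun b => concat (happly (join_rec_inr _ b) e)
     (concat (concat (join_rec_inl _ (north SA))
        (ap (join_inr J) (hmul_1l mul b))) (inverse idpath)))
  (fun a b => transport_homotopy (F := fun x => join_mul x e)
     (G := fun x => x) (gam := join_glue J a b) (ap_join_mul_glue a b e) _ _)).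
- destruct (join_glue J a b); exact idpath.
(* At [inl 1] the homotopy computes to the glue path from [a 1] to [1 b]; once the point rules
   cancel, naturality of glue along the unit laws remains. *)
- refine (concat _ (ap (fun q => concat q _)
    (inverse (join_ind_inl J (fun y => join_mul_inl a y == join_mul_inr b y)
       _ _ _ (north SA))))).
  refine (concat _ (inverse (concat_pp_V_p _ _ _ _))).
  refine (concat (concat_pp_p _ _ _) (ap (concat _) _)).
  apply join_glue_natural.
Defined.

Definition join_HSpace : HSpace (join_inl J (north SA)).
Proof.
refine {| hmul := join_mul; hmul_1l := join_mul_1l; hmul_1r := join_mul_1r |};
  refine (join_connected (x0 := north SA) (north SA) _);
  apply contr_isequiv_idmap; auto using join_mul_1l, join_mul_1r.
Defined.

End GroupLikeSuspension.

Theorem mainTheorem3 (funext : Funext) (A : Type) (SA : Suspension A)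
    (I : CayleyDicksonImaginaroid SA)
    (assoc : forall x y z : SA,
       cd_mul I (cd_mul I x y) z == cd_mul I x (cd_mul I y z))
    (J : Join SA SA) :
  { e : J & HSpace e }.
Proof.
exists (join_inl J (north SA)).
(* Conjugation serves as [inv]. *)
exact (join_HSpace funext assoc (cd_mul_conj I) J).
Qed.
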